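(* Let $G=(V,E)\in\mathfrak{Gr}(n,k,\ell)$ with $n>k$ and $\ell\ge 2$. Then: (i) for all $x\in V$, $\ell+1<n-k+\ell+1\le|N[x]|\le k-\ell$; in other words, the minimum degree of $G$ is at least $n-k+\ell$ and the maximum degree is at most $k-\ell-1$; (ii) for all distinct $x,y\in V$, $|N[x]\cap N[y]|\le k-2\ell+1$; (iii) $n\le 2k-2\ell-1$ and $k\ge 2\ell+2$.
   Context: All graphs are finite, simple and undirected. For a graph $G=(V,E)$ and $x\in V$, $N[x]=\{x\}\cup\{y: xy\in E\}$; for $X\subseteq V$, $N[X]=\bigcup_{x\in X}N[x]$ (so $N[\emptyset]=\emptyset$). A set $C\subseteq V$ is $(1,\le\ell)$-identifying if $N[X]\cap C\neq N[Y]\cap C$ for all distinct $X,Y\subseteq V$ with $|X|\le\ell$, $|Y|\le\ell$. For $n\ge k\ge1$ and $\ell\ge1$, $\mathfrak{Gr}(n,k,\ell)$ is the set of graphs on $n$ vertices in which every $k$-element subset of vertices is $(1,\le\ell)$-identifying. *)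

(* Defs.v *)
From mathcomp Require Import all_boot all_order all_algebra.

Set Implicit Arguments.
Unset Strict Implicit.
Unset Printing Implicit Defensive.

Record sgraph := SGraph {
  vertex :> finType;
  adj : rel vertex;
  adj_sym : symmetric adj;
  adj_irr : irreflexive adj
}.

Definition open_nbhd (G : sgraph) (x : G) : {set G} := [set y | adj x y].

Definition closed_nbhd (G : sgraph) (x : G) : {set G} := x |: open_nbhd x.

Definition closed_nbhd_set (G : sgraph) (X : {set G}) : {set G} :=
  \bigcup_(x in X) closed_nbhd x.

Definition degree (G : sgraph) (x : G) : nat := #|open_nbhd x|.

(* Every degree is below #|G|, so on a nonempty graph the default value #|G|
   is never attained and this is the usual minimum. *)
Definition min_degree (G : sgraph) : nat := \big[minn/#|G|]_(x : G) degree x.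

Definition max_degree (G : sgraph) : nat := \max_(x : G) degree x.

(* C is (1, <= l)-identifying; the empty set is allowed as X or Y. *)
Definition identifying (G : sgraph) (l : nat) (C : {set G}) : Prop :=
  forall X Y : {set G}, X != Y -> #|X| <= l -> #|Y| <= l ->
    closed_nbhd_set X :&: C != closed_nbhd_set Y :&: C.

(* Membership in Gr(n, k, l), which is meant for 1 <= k <= n and 1 <= l. *)
Definition in_Gr (n k l : nat) (G : sgraph) : Prop :=
  #|G| = n /\ forall C : {set G}, #|C| = k -> identifying l C.

(* Main.v *)
Require Import Defs.
From mathcomp Require Import all_boot all_order all_algebra.
From mathcomp Require Import zify.

(** If every k-set is identifying, then N[X] and N[Y] differ in more than n - k
    places, since otherwise some k-set avoids the symmetric difference.  In
    particular a vertex x outside X, |X| < l, has more than n - k private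
    neighbours, i.e. elements of N[x] \ N[X]; enlarging X by up to l - 1 - |X|
    vertices taken from N[x] \ N[X] itself shows that there must be that many
    more of them.  Taking X = {y} bounds |N[x] \ N[y]| from below: with y adjacent
    to x this gives the minimum degree, and with y arbitrary it gives a bound on
    the complement of N[y] which cannot be attained, since then any two pairs
    {y, x} and {y, x'} would both dominate the graph. *)

Lemma exists_subset_card (T : finType) (A : {set T}) (m : nat) :
  m <= #|A| -> exists2 B : {set T}, B \subset A & #|B| = m.
Proof.
move=> /card_geqP [s [us ss sA]]; exists [set x in s].
  by apply/subsetP => x; rewrite inE => /sA.
by rewrite cardsE -ss; apply/card_uniqP.
Qed.

Section ClosedNeighbourhoods.
Variable G : sgraph.
Implicit Types (x y : G) (X Y : {set G}).

Lemma closed_nbhd_refl x : x \in closed_nbhd x.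
Proof. exact: setU11. Qed.

Lemma closed_nbhd_sym x y : (x \in closed_nbhd y) = (y \in closed_nbhd x).
Proof. by rewrite !inE eq_sym adj_sym. Qed.

Lemma closed_nbhd_set1 x : closed_nbhd_set [set x] = closed_nbhd x.
Proof. exact: big_set1. Qed.

Lemma closed_nbhd_setU X Y :
  closed_nbhd_set (X :|: Y) = closed_nbhd_set X :|: closed_nbhd_set Y.
Proof. exact: bigcup_setU. Qed.

Lemma closed_nbhd_set_refl X : X \subset closed_nbhd_set X.
Proof.
by apply/subsetP => x xX; apply/bigcupP; exists x => //; apply: closed_nbhd_refl.
Qed.

Lemma card_closed_nbhd x : #|closed_nbhd x| = (degree x).+1.
Proof. by rewrite cardsU1 inE adj_irr. Qed.

End ClosedNeighbourhoods.

Section Gr.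
Variables (n k l : nat) (G : sgraph).
Hypotheses (hkn : k < n) (hG : in_Gr n k l G).
Implicit Types (x y : G) (X Y : {set G}).

Lemma card_symdiff_gt X Y : X != Y -> #|X| <= l -> #|Y| <= l ->
  n - k < #|closed_nbhd_set X :\: closed_nbhd_set Y| +
          #|closed_nbhd_set Y :\: closed_nbhd_set X|.
Proof.
move=> neqXY leX leY; have [cardG idG] := hG.
set A := closed_nbhd_set X; set B := closed_nbhd_set Y.
rewrite ltnNge; apply/negP => leD.
have [] := @exists_subset_card _ (~: ((A :\: B) :|: (B :\: A))) k.
  rewrite cardsCs setCK cardG.
  have := leq_card_setU (A :\: B) (B :\: A).
  by move=> [+ _]; lia.
move=> C /subsetP sC /idG /(_ X Y neqXY leX leY) /negP; apply; apply/eqP/setP.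
move=> z; rewrite !inE; case zC: (z \in C); rewrite ?andbF //.
by have := sC _ zC; rewrite !inE; case: (z \in A); case: (z \in B).
Qed.

(** Compare [x |: X] with [X]: one half of the symmetric difference is empty by monotonicity, and
    [#|X| < l] leaves room for [x]. *)
Lemma card_private_gt x X : x \notin X -> #|X| < l ->
  n - k < #|closed_nbhd x :\: closed_nbhd_set X|.
Proof.
move=> xX ltX; have := @card_symdiff_gt (x |: X) X.
rewrite cardsU1 xX closed_nbhd_setU closed_nbhd_set1.
have -> : closed_nbhd_set X :\: (closed_nbhd x :|: closed_nbhd_set X) = set0.
  by apply/eqP; rewrite setD_eq0 subsetUr.
rewrite cards0 addn0 setDUl setDv setU0; apply => //; last exact: ltnW.
by apply: contraNneq xX => <-; apply: setU11.
Qed.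

Lemma card_private_ge x X : x \notin X -> #|X| < l ->
  n - k + (l - #|X|) <= #|closed_nbhd x :\: closed_nbhd_set X|.
Proof.
move=> xX ltX; set P := _ :\: _.
(* The size keeps [X :|: T] below [l] elements, and omitting [x] keeps it outside; both are needed
   for [card_private_gt]. *)
have [] := @exists_subset_card _ (P :\ x) (minn (l.-1 - #|X|) #|P :\ x|).
  exact: geq_minr.
move=> T sT cardT.
have xT : x \notin T by apply/negP => /(subsetP sT); rewrite !inE eqxx.
have TP : T \subset P by apply: subset_trans sT (subsetDl _ _).
have ltXT : #|X :|: T| < l.
  have [+ _] := leq_card_setU X T.
  by have := geq_minl (l.-1 - #|X|) #|P :\ x|; lia.
have := @card_private_gt x (X :|: T).
rewrite inE negb_or xX xT closed_nbhd_setU -setDDl -/P => /(_ isT ltXT) gtPT.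
have lePT : #|P :\: closed_nbhd_set T| <= #|P| - #|T|.
  rewrite -(cardsDS TP); apply/subset_leq_card/setDS/closed_nbhd_set_refl.
(* T cannot be all of P :\ x, as then at most x itself would remain private. *)
have := cardsD1 x P; have : (x \in P) <= 1 by case: (x \in P).
have := subset_leq_card TP; move: cardT; rewrite /minn; case: ltnP; lia.
Qed.

Hypothesis hl : 2 <= l.

Lemma card_nbhdD_ge x y : x != y ->
  n - k + l.-1 <= #|closed_nbhd x :\: closed_nbhd y|.
Proof.
move=> neqxy; have := @card_private_ge x [set y].
by rewrite inE cards1 closed_nbhd_set1 subn1; apply.
Qed.

Lemma card_closed_nbhd_ge x : n - k + l.+1 <= #|closed_nbhd x|.
Proof.
(* With [X] empty, [card_private_ge] gives at least n - k + l > 1 elements of N[x], hence a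
   neighbour. *)
have : 0 < #|open_nbhd x|.
  have := @card_private_ge x set0.
  rewrite inE cards0 => /(_ isT (ltnW hl)).
  have := subset_leq_card (subsetDl (closed_nbhd x) (closed_nbhd_set set0)).
  by have := card_closed_nbhd G x; rewrite /degree; lia.
case/card_gt0P => y xy.
have neqxy : x != y by apply: contraTneq xy => <-; rewrite inE adj_irr.
have yx : y \in closed_nbhd x by rewrite inE xy orbT.
(* These two common elements raise n - k + l - 1 to n - k + l + 1. *)
have sI : [set x; y] \subset closed_nbhd x :&: closed_nbhd y.
  by rewrite subUset !sub1set !(in_setI, closed_nbhd_refl, yx) closed_nbhd_sym yx.
have := subset_leq_card sI; rewrite cards2 neqxy.
have := card_nbhdD_ge _ _ neqxy; have := cardsID (closed_nbhd y) (closed_nbhd x); lia.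
Qed.

Lemma card_closed_nbhd_le x : #|closed_nbhd x| + l <= k.
Proof.
have [cardG _] := hG; set W := ~: closed_nbhd x.
(* Any y other than x already gives n - k + l - 1 elements of [W], so only equality has to be
   excluded. *)
suff : n - k + l <= #|W| by have := cardsC (closed_nbhd x); rewrite -/W cardG; lia.
rewrite leqNgt; apply/negP => ltW.
(* Otherwise x and any other vertex dominate the graph. *)
have dom y : y != x -> closed_nbhd_set [set x; y] = setT.
  move=> neqyx; have leD := card_nbhdD_ge _ _ neqyx.
  have sW : closed_nbhd y :\: closed_nbhd x \subset W by rewrite setDE subsetIr.
  have /eqP eW : closed_nbhd y :\: closed_nbhd x == W.
    by rewrite eqEcard sW; lia.
  by rewrite closed_nbhd_setU !closed_nbhd_set1 -(setUCr (closed_nbhd x)) -/W -eW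
             setDE setUIr setUCr setIT.
(* Two further vertices are needed to form two distinct dominating pairs. *)
have cardx : 1 < #|[set: G] :\ x|.
  have := subset_leq_card (subsetT (closed_nbhd x)).
  by have := cardsD1 x setT; have := card_closed_nbhd_ge x; rewrite inE; lia.
case/card_gt1P: cardx => y [z [+ + neqyz]].
rewrite !inE !andbT => neqyx neqzx.
have := @card_symdiff_gt [set x; y] [set x; z].
rewrite !dom // setDv cards0 ltn0 !cards2 !(eq_sym x) neqyx neqzx.
suff neqXY : [set x; y] != [set x; z] by move=> /(_ neqXY hl hl).
by apply: contra_neq neqyz => /setP /(_ y); rewrite !inE eqxx (negPf neqyx) => /esym /eqP.
Qed.

(** Remove N[x] \ N[y], of size at least n - k + l - 1 >= l, from N[x], of size at most k - l. *)
Lemma card_closed_nbhdI_le x y : x != y ->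
  #|closed_nbhd x :&: closed_nbhd y| + 2 * l <= k.
Proof.
move=> /card_nbhdD_ge; have := cardsID (closed_nbhd y) (closed_nbhd x).
by have := card_closed_nbhd_le x; lia.
Qed.

End Gr.

Theorem theorem34 (n k l : nat) (G : sgraph)
    (hk : (1 <= k)%N) (hkn : (k < n)%N) (hl : (2 <= l)%N)
    (hG : in_Gr n k l G) :
  [/\ (forall x : G,
          [/\ (l%:Z + 1 < n%:Z - k%:Z + l%:Z + 1)%R,
              (n%:Z - k%:Z + l%:Z + 1 <= #|closed_nbhd x|%:Z)%R
            & (#|closed_nbhd x|%:Z <= k%:Z - l%:Z)%R])
      /\ (n%:Z - k%:Z + l%:Z <= (min_degree G)%:Z)%R
      /\ ((max_degree G)%:Z <= k%:Z - l%:Z - 1)%R,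
      (forall x y : G, x != y ->
          (#|closed_nbhd x :&: closed_nbhd y|%:Z <= k%:Z - 2 * l%:Z + 1)%R)
    & (n%:Z <= 2 * k%:Z - 2 * l%:Z - 1)%R /\ (2 * l + 2 <= k)%N].
Proof.
have ge_nbhd x := @card_closed_nbhd_ge n k l G hkn hG hl x.
have le_nbhd x := @card_closed_nbhd_le n k l G hkn hG hl x.
have [x0] : exists x0 : G, x0 \in G.
  by apply/card_gt0P; case: hG => -> _; lia.
(* Both bounds at one vertex give n - k + l + 1 <= k - l, and then n > k gives the bound on k. *)
have := ge_nbhd x0; have := le_nbhd x0 => le0 ge0 _.
have min_ge : n - k + l <= min_degree G.
  apply: (big_ind (fun m => n - k + l <= m)).
  (* The default value [#|G|] = n passes because [le0] forces l <= k. *)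
  - by case: hG => -> _; lia.
  - by move=> a b ha hb; rewrite leq_min ha hb.
  - by move=> x _; have := ge_nbhd x; rewrite card_closed_nbhd; lia.
have max_le : max_degree G <= k - l - 1.
  by apply/bigmax_leqP => x _; have := le_nbhd x; rewrite card_closed_nbhd; lia.
split.
- split; first by move=> x; have := ge_nbhd x; have := le_nbhd x; split; lia.
  by split; lia.
- by move=> x y /(card_closed_nbhdI_le _ _ _ _ hkn hG hl); lia.
- by split; lia.
Qed.
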